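(* Let $\Omega$ be a finite set (of genres), $p$ a probability distribution on $\Omega$, $M$ a finite set of movies where each $i \in M$ has a probability distribution $p(\cdot \mid i)$ on $\Omega$, $k \ge 1$ an integer, and $w_1 \ge w_2 \ge \dots \ge w_k \ge 0$ weights with $\sum_{j=1}^k w_j = 1$. For a sequence $I = i_1 \dots i_\ell$ of movies with $\ell \le k$, let $q_I(x) = \sum_{j=1}^{\ell} w_j\, p(x \mid i_j)$ for $x \in \Omega$. Let $D_f$ be a bounded $f$-divergence with maximum value $d^* = \max_{(p',q')} D_f(p',q')$ over distributions $p'$ and subdistributions $q'$ on $\Omega$, and define the $D_f$-overlap measure $G_{D_f}(p,q) = d^* - D_f(p,q)$. Then the sequence function $F(I) = G_{D_f}(p, q_I)$ is ordered-submodular, and consequently the greedy algorithm produces a length-$k$ list $A_k$ with $F(A_k) \ge \frac12 \max\{F(I) : I \text{ a sequence of } k \text{ movies}\}$.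
   Context: A subdistribution on $\Omega$ is a vector of nonnegative numbers indexed by $\Omega$ summing to at most $1$; each $q_I$ is a subdistribution. For a function $f:[0,\infty)\to\mathbb{R}$ convex with $f(1)=0$, the $f$-divergence is $D_f(p,q) = \sum_{x \in \Omega} f\!\left(\frac{p(x)}{q(x)}\right) q(x)$ (evaluated via its explicit formula also when $q$ is a subdistribution); it is bounded if it attains a finite maximum $d^*$ over all pairs of a distribution and a subdistribution. For sequences $A, B$, $A\|B$ denotes concatenation and $A\|s$ denotes $A$ with element $s$ appended. A function $F$ on sequences of movies is ordered-submodular if for all sequences $A, B$ and movies $s, \bar s$ (here with all sequences involved of length at most $k$): $F(A\|s) - F(A) \ge F(A\|s\|B) - F(A\|\bar s\|B)$. The greedy algorithm: $A_0 = \emptyset$; for $\ell=1,\dots,k$, $A_\ell = A_{\ell-1}\|a$ where $a \in M$ maximizes $F(A_{\ell-1}\|a)$, ties broken arbitrarily.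
   Formalization: Ordered submodularity is proved only when f(0) ≤ 0; without this it fails (f(t)=|t-1|/2, p and the only movie being distinct point masses, k=1: adding the movie lowers F). The greedy 1/2 guarantee is proved for every bounded D_f. *)

(* Defs.v *)
From HB Require Import structures.
From mathcomp Require Import all_boot all_order all_algebra.
From mathcomp Require Import all_classical all_reals all_analysis.

Set Implicit Arguments.
Unset Strict Implicit.
Unset Printing Implicit Defensive.

Import Order.TTheory GRing.Theory Num.Theory.
Import numFieldNormedType.Exports.
Local Open Scope classical_set_scope.
Local Open Scope ring_scope.

Definition is_distribution (R : realType) (Omega : finType) (p : Omega -> R) : Prop :=
  (forall x, 0 <= p x) /\ \sum_x p x = 1.

Definition is_subdistribution (R : realType) (Omega : finType) (q : Omega -> R) : Prop :=
  (forall x, 0 <= q x) /\ \sum_x q x <= 1.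

(* f (u / v) * v, with the usual conventions 0 f(0/0) = 0 and
   0 f(u/0) = u lim_(t -> +oo) f(t) / t; the limit exists in \bar R when f is
   convex on [0, +oo[. *)
Definition fdiv_term (R : realType) (f : R -> R) (u v : R) : \bar R :=
  if v == 0 then (u%:E * lim ((f t / t)%:E @[t --> +oo%R]))%E
  else (f (u / v) * v)%:E.

(* On distributions this is unchanged when f is replaced by
   f + c (t - 1); on subdistributions it is not: the replacement adds
   c (1 - \sum_x q x). *)
Definition fdiv (R : realType) (Omega : finType) (f : R -> R) (p q : Omega -> R) :
  \bar R := (\sum_x fdiv_term f (p x) (q x))%E.

(* D_f is bounded on Omega, with (attained) maximum d *)
Definition fdiv_max (R : realType) (Omega : finType) (f : R -> R) (d : R) : Prop :=
  (exists p q : Omega -> R,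
      [/\ is_distribution p, is_subdistribution q & fdiv f p q = d%:E]) /\
  (forall p q : Omega -> R,
      is_distribution p -> is_subdistribution q -> (fdiv f p q <= d%:E)%E).

(* fine is harmless here: fdiv f p q is finite when D_f is bounded. *)
Definition overlap (R : realType) (Omega : finType) (f : R -> R) (d : R)
  (p q : Omega -> R) : R := d - fine (fdiv f p q).

(* Weights are numbered from 0, so w`_j is the weight of the item at position j
   of I. *)
Definition mixture (R : realType) (Omega M : finType) (k : nat) (w : k.-tuple R)
  (P : M -> Omega -> R) (I : seq M) (x : Omega) : R :=
  \sum_(j < size I) w`_j * P (tnth (in_tuple I) j) x.

Definition ordered_submodular (R : realType) (M : finType) (k : nat)
  (F : seq M -> R) : Prop :=
  forall (A B : seq M) (s s' : M), (size (rcons A s ++ B) <= k)%N ->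
    F (rcons A s) - F A >= F (rcons A s ++ B) - F (rcons A s' ++ B).

(* greedy F l A : A is a possible list A_l after l steps, over all ways of
   breaking ties. *)
Inductive greedy (R : realType) (M : finType) (F : seq M -> R) :
  nat -> seq M -> Prop :=
| greedy_nil : greedy F 0 [::]
| greedy_step l A a : greedy F l A ->
    (forall b, F (rcons A b) <= F (rcons A a)) -> greedy F l.+1 (rcons A a).

Definition is_max (R : realType) (S : set R) (m : R) : Prop := S m /\ ubound S m.

(* Main.v *)
Require Import Defs.
From HB Require Import structures.
From mathcomp Require Import all_boot all_order all_algebra.
From mathcomp Require Import all_classical all_reals all_analysis.
From mathcomp Require Import ring lra.

Set Implicit Arguments.
Unset Strict Implicit.
Unset Printing Implicit Defensive.

Import Order.TTheory GRing.Theory Num.Theory.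
Import numFieldNormedType.Exports.
Local Open Scope classical_set_scope.
Local Open Scope ring_scope.

(* Boundedness of D_f forces L = lim f(t)/t to be finite, and L is also the
   supremum of the slopes (f t - f 0)/t.  The perspective g(u, v) = v f(u/v),
   with g(u, 0) = u L, is then positively homogeneous and subadditive on the
   quadrant, and g(0, v) = f(0) v.  Subadditivity yields convexity in v, hence
   diminishing increments, and g(u, v + a) <= g(u, v) + f(0) a.  Together these give
     F(A||s||B) - F(A||s'||B) <= F(A||s) - F(A) + f(0) w_|A|,
   which is ordered submodularity when f(0) <= 0.  For the greedy list the slacks
   sum to f(0), so 2 F(A_k) >= F(OPT) + F([::]) - f(0) for any sign of f(0), and
   F([::]) - f(0) = d - (L + f(0)) >= 0 because L + f(0) is the divergence of two
   distinct point masses.  When Omega is a single point, F is constantly d >= 0 on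
   lists of length k. *)

(** * Chord slopes of a convex function and its slope at infinity *)

Lemma convex_weighted (R : realType) (f : R -> R) (a b x y : R) :
  convex_function (`[0, +oo[%classic : set R^o) f ->
  0 <= a -> 0 <= b -> 0 < a + b -> 0 <= x -> 0 <= y ->
  f ((a * x + b * y) / (a + b)) * (a + b) <= a * f x + b * f y.
Proof.
move=> cf a0 b0 ab0 x0 y0; rewrite -ler_pdivlMr//.
have t01 : Itv.spec (@Itv.num_sem R) (Itv.Real `[0, 1]%Z) (a / (a + b)).
  rewrite /= /Itv.num_sem/= realE divr_ge0 ?(ltW ab0)//= in_itv/=.
  by rewrite divr_ge0 ?(ltW ab0)//= ler_pdivrMr// mul1r lerDl.
have := cf (Itv.mk t01) x y.
rewrite !inE/= !in_itv/= !andbT => /(_ x0 y0).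
rewrite !convRE /=.
set z := conv _ _ _; have -> : z = (a * x + b * y) / (a + b).
  rewrite [z](_ : _ = a / (a + b) * x + (1 - a / (a + b)) * y)//.
  by field; rewrite gt_eqF.
move=> /le_trans; apply; rewrite le_eqVlt; apply/orP; left; apply/eqP.
by rewrite /unstable.onem; field; rewrite gt_eqF.
Qed.

(** Chord slopes from [a] increase; the cross-multiplied form also covers [a = b]. *)
Lemma convex_slope (R : realType) (f : R -> R) (a b c : R) :
  convex_function (`[0, +oo[%classic : set R^o) f ->
  0 <= a -> a <= b -> b <= c -> (f b - f a) * (c - a) <= (f c - f a) * (b - a).
Proof.
move=> cf a0 ab bc; have [ac|ac] := ltP a c; last first.
  have cb : c = b by apply/le_anti; rewrite bc (le_trans ac).
  by rewrite cb.
have ca0 : 0 < (c - b) + (b - a) by lra.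
have := convex_weighted cf (_ : 0 <= c - b) (_ : 0 <= b - a) ca0 a0 (_ : 0 <= c).
have -> : ((c - b) * a + (b - a) * c) / (c - b + (b - a)) = b.
  by field; rewrite gt_eqF.
by move=> /(_ ltac:(lra) ltac:(lra) ltac:(lra)); nra.
Qed.

(** A supremum rather than the limit of [f t / t]: it bounds [f] at every point, and the limit is
    identified with it afterwards. *)
Definition recession_slope (R : realType) (f : R -> R) : R :=
  sup [set (f t - f 0) / t | t in [set t | 0 < t]].

Definition linearly_bounded (R : realType) (f : R -> R) : Prop :=
  exists D : R, forall t, 1 <= t -> f t <= D * t.

(** Linear growth bounds the slopes from 1 on; by monotonicity the earlier ones are at most the
    slope at 1. *)
Lemma slope0_has_sup (R : realType) (f : R -> R) :
  convex_function (`[0, +oo[%classic : set R^o) f -> linearly_bounded f ->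
  has_sup [set (f t - f 0) / t | t in [set t | 0 < t]].
Proof.
move=> cf [D fD]; split; first by exists ((f 1 - f 0) / 1); exists 1 => //=; lra.
exists (D + `|f 0|) => _ [t /= t0 <-]; rewrite ler_pdivrMr//.
have := ler_norm (- f 0); rewrite normrN => f0.
have := normr_ge0 (f 0) => n0.
have [t1|t1] := leP 1 t; first by have := fD t t1; nra.
have := convex_slope cf (lexx 0) (ltW t0) (ltW t1).
have := fD 1 (lexx 1); rewrite !subr0 !mulr1 => fD1; nra.
Qed.

Lemma le_recession0 (R : realType) (f : R -> R) (t : R) :
  convex_function (`[0, +oo[%classic : set R^o) f -> linearly_bounded f ->
  0 <= t -> f t <= f 0 + recession_slope f * t.
Proof.
move=> cf bf; rewrite le_eqVlt => /predU1P[<-|t0]; first by rewrite mulr0 addr0.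
rewrite -lerBlDl -ler_pdivrMr//; apply: sup_upper_bound; last by exists t.
exact: slope0_has_sup.
Qed.

(** A chord steeper than [L] would keep [f] above its extension, hence eventually above the line of
    slope [L] through [f 0]. *)
Lemma le_recession (R : realType) (f : R -> R) (s t : R) :
  convex_function (`[0, +oo[%classic : set R^o) f -> linearly_bounded f ->
  0 <= s -> s <= t -> f t <= f s + recession_slope f * (t - s).
Proof.
move=> cf bf s0; rewrite le_eqVlt => /predU1P[<-|st].
  by rewrite subrr mulr0 addr0.
rewrite leNgt; apply/negP => fst; set L := recession_slope f in fst.
have ts0 : 0 < t - s by lra.
pose e := f t - f s - L * (t - s); have e0 : 0 < e by rewrite /e; lra.
(* far enough out, the chord through [s] and [t] exceeds [f 0 + L r] *)
pose r := t + (`|f 0 + L * s - f s| + 1) * (t - s) / e.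
have tr : t <= r.
  by rewrite /r lerDl divr_ge0 ?(ltW e0)// mulr_ge0 ?(ltW ts0)// addr_ge0.
have := convex_slope cf s0 (ltW st) tr.
have := le_recession0 cf bf (_ : 0 <= r); rewrite -/L => /(_ ltac:(lra)) fr.
have := ler_norm (f 0 + L * s - f s).
have : (r - t) * e = (`|f 0 + L * s - f s| + 1) * (t - s).
  by rewrite /r; field; rewrite gt_eqF.
move: (`|_|) => N rte hN.
have -> : f t - f s = e + L * (t - s) by rewrite /e; ring.
nra.
Qed.

Lemma cvg_recession_slope (R : realType) (f : R -> R) :
  convex_function (`[0, +oo[%classic : set R^o) f -> linearly_bounded f ->
  f t / t @[t --> +oo%R] --> recession_slope f.
Proof.
move=> cf bf; apply/cvgrPdist_le => e e0.
have e20 : 0 < e / 2 by rewrite divr_gt0.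
(* A slope within [e / 2] of the supremum bounds all later slopes from below; the other [e / 2]
   absorbs [f 0 / t]. *)
have [_ [t0 /= t00 <-]] := sup_adherent e20 (slope0_has_sup cf bf).
rewrite -/(recession_slope f); set L := recession_slope f => Lt0.
near=> t.
have tt0 : t0 <= t by near: t; apply: nbhs_pinfty_ge; rewrite num_real.
have t_gt0 : 0 < t by lra.
have f0t : `|f 0| * 2 / e <= t by near: t; apply: nbhs_pinfty_ge; rewrite num_real.
have {}f0t : `|f 0| <= e / 2 * t.
  by move: f0t; rewrite ler_pdivrMr// => ?; lra.
have ft := le_recession0 cf bf (ltW t_gt0); rewrite -/L in ft.
have := convex_slope cf (lexx 0) (ltW t00) tt0; rewrite !subr0 => sl.
have {}sl : (L - e / 2) * t <= f t - f 0.
  rewrite ltr_pdivlMr// in Lt0.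
  rewrite -(ler_pM2r t00); nra.
move: f0t; rewrite ler_norml => /andP[f01 f02].
have -> : L - f t / t = (L * t - f t) / t by field; rewrite gt_eqF.
rewrite ler_norml ler_pdivlMr// ler_pdivrMr//; apply/andP; split; lra.
Unshelve. all: by end_near.
Qed.

(** * The perspective of [f], with real values *)

Definition persp (R : realType) (f : R -> R) (u v : R) : R :=
  if v == 0 then u * recession_slope f else f (u / v) * v.

Lemma fdiv_termE (R : realType) (f : R -> R) (u v : R) :
  convex_function (`[0, +oo[%classic : set R^o) f -> linearly_bounded f ->
  fdiv_term f u v = (persp f u v)%:E.
Proof.
move=> cf bf; rewrite /fdiv_term /persp; case: ifP => // _; rewrite EFinM.
congr (_ * _)%E; apply: cvg_lim => //.
by apply: cvg_EFin; [exact: nearW | exact: cvg_recession_slope].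
Qed.

Lemma fdivE (R : realType) (Omega : finType) (f : R -> R) (p q : Omega -> R) :
  convex_function (`[0, +oo[%classic : set R^o) f -> linearly_bounded f ->
  fdiv f p q = (\sum_x persp f (p x) (q x))%:E.
Proof.
by move=> cf bf; rewrite -sumEFin; apply: eq_bigr => x _; exact: fdiv_termE.
Qed.

Lemma persp0l (R : realType) (f : R -> R) (v : R) : persp f 0 v = f 0 * v.
Proof. by rewrite /persp; case: eqVneq => [->|_]; rewrite !(mul0r, mulr0). Qed.

Lemma perspxx (R : realType) (f : R -> R) (u : R) : f 1 = 0 -> persp f u u = 0.
Proof.
move=> f1; rewrite /persp; case: eqVneq => [->|u0]; first by rewrite mul0r.
by rewrite divff// f1 mul0r.
Qed.

Lemma perspZ (R : realType) (f : R -> R) (c u v : R) :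
  persp f (c * u) (c * v) = c * persp f u v.
Proof.
have [->|c0] := eqVneq c 0; first by rewrite !mul0r persp0l mulr0.
rewrite /persp mulf_eq0 (negPf c0)/=; case: eqVneq => [_|v0]; first by rewrite mulrA.
by rewrite -mulf_div divff// mul1r mulrCA.
Qed.

(** For positive [v1] and [v2] this is Jensen at [u1 / v1] and [u2 / v2] with weights [v1] and
    [v2]. *)
Lemma perspD (R : realType) (f : R -> R) (u1 u2 v1 v2 : R) :
  convex_function (`[0, +oo[%classic : set R^o) f -> linearly_bounded f ->
  0 <= u1 -> 0 <= u2 -> 0 <= v1 -> 0 <= v2 ->
  persp f (u1 + u2) (v1 + v2) <= persp f u1 v1 + persp f u2 v2.
Proof.
move=> cf bf u10 u20 v10 v20.
(* The case of one zero second argument: raising [b / c] to [(a + b) / c] costs slope at most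
   [recession_slope f]. *)
have D0 (a b c : R) : 0 <= a -> 0 <= b -> 0 < c ->
    persp f (a + b) c <= a * recession_slope f + persp f b c.
  move=> a0 b0 c0; rewrite /persp gt_eqF// -ler_pdivlMr// [leRHS]mulrDl mulfK ?gt_eqF//.
  have bc : b / c <= (a + b) / c by rewrite ler_pM2r ?invr_gt0// lerDr.
  have := le_recession cf bf (divr_ge0 b0 (ltW c0)) bc.
  move=> /le_trans; apply; rewrite le_eqVlt; apply/orP; left; apply/eqP.
  by field; rewrite gt_eqF.
have [v1E|v1N] := eqVneq v1 0; have [v2E|v2N] := eqVneq v2 0.
- by rewrite v1E v2E addr0 /persp eqxx mulrDl.
- by rewrite v1E add0r {2}/persp eqxx D0// lt_neqAle eq_sym v2N.
- by rewrite v2E addr0 addrC [leRHS]addrC {2}/persp eqxx D0// lt_neqAle eq_sym v1N.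
have v1_gt0 : 0 < v1 by rewrite lt_neqAle eq_sym v1N.
have v2_gt0 : 0 < v2 by rewrite lt_neqAle eq_sym v2N.
have v12 := addr_gt0 v1_gt0 v2_gt0.
have := convex_weighted cf v10 v20 v12 (divr_ge0 u10 v10) (divr_ge0 u20 v20).
rewrite ![_ * (_ / _)]mulrC !divfK// /persp (gt_eqF v12) (negPf v1N) (negPf v2N).
by rewrite [v1 * _]mulrC [v2 * _]mulrC.
Qed.

(** Both [v + a] and [v + b] divide the segment from [v] to [v + a + b], with complementary
    weights. *)
Lemma persp_increments (R : realType) (f : R -> R) (u v a b : R) :
  convex_function (`[0, +oo[%classic : set R^o) f -> linearly_bounded f ->
  0 <= u -> 0 <= v -> 0 <= a -> 0 <= b ->
  persp f u (v + a) + persp f u (v + b) <= persp f u v + persp f u (v + a + b).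
Proof.
move=> cf bf u0 v0 a0 b0; have [ab|ab] := ltP 0 (a + b); last first.
  have [-> ->] : a = 0 /\ b = 0 by lra.
  by rewrite !addr0.
(* [v + c] is a convex combination of [v] and [v + a + b] with weight [t] *)
have H (c : R) (t := c / (a + b)) : 0 <= c -> c <= a + b ->
    persp f u (v + c) <= (1 - t) * persp f u v + t * persp f u (v + a + b).
  move=> c0 cab.
  have t0 : 0 <= t by rewrite divr_ge0// ltW.
  have t1 : 0 <= 1 - t by rewrite subr_ge0 ler_pdivrMr// mul1r.
  rewrite -!perspZ.
  have -> : persp f u (v + c) =
    persp f ((1 - t) * u + t * u) ((1 - t) * v + t * (v + a + b)).
    by congr persp; rewrite /t; field; rewrite gt_eqF.
  by apply: perspD => //; rewrite mulr_ge0// ?addr_ge0.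
apply: le_trans (lerD (H a _ _) (H b _ _)) _; try lra.
rewrite le_eqVlt; apply/orP; left; apply/eqP.
by field; rewrite gt_eqF.
Qed.

(** Here [v], [a], [a'], [b] stand for the contributions of [A], [s], [s'], [B]. Diminishing
    increments handle [a]; adding the pair [(0, a')] costs at most [f 0 * a']. *)
Lemma persp_exchange (R : realType) (f : R -> R) (u v a a' b : R) :
  convex_function (`[0, +oo[%classic : set R^o) f -> linearly_bounded f ->
  0 <= u -> 0 <= v -> 0 <= a -> 0 <= a' -> 0 <= b ->
  persp f u (v + a) - persp f u v
    <= persp f u (v + a + b) - persp f u (v + a' + b) + f 0 * a'.
Proof.
move=> cf bf u0 v0 a0 a'0 b0.
have := persp_increments cf bf u0 v0 a0 b0.
have := perspD cf bf u0 (lexx 0) (addr_ge0 v0 b0) a'0.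
rewrite addr0 persp0l addrAC; lra.
Qed.

(** * Mixtures cut at a position *)

Definition mixture_from (R : realType) (Omega M : finType) (k : nat)
    (w : k.-tuple R) (P : M -> Omega -> R) (n : nat) (I : seq M) (x : Omega) : R :=
  \sum_(j < size I) w`_(n + j) * P (tnth (in_tuple I) j) x.

Lemma mixture_from_ge0 (R : realType) (Omega M : finType) (k : nat)
    (w : k.-tuple R) (P : M -> Omega -> R) (n : nat) (I : seq M) (x : Omega) :
  (forall j, 0 <= w`_j) -> (forall i, is_distribution (P i)) ->
  0 <= mixture_from w P n I x.
Proof.
by move=> w0 hP; apply: sumr_ge0 => j _; rewrite mulr_ge0//; exact: (hP _).1.
Qed.

Lemma mixture_from_cons (R : realType) (Omega M : finType) (k : nat)
    (w : k.-tuple R) (P : M -> Omega -> R) (n : nat) (s : M) (I : seq M) (x : Omega) :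
  mixture_from w P n (s :: I) x = w`_n * P s x + mixture_from w P n.+1 I x.
Proof.
rewrite /mixture_from big_ord_recl addn0; congr (_ * P _ _ + _).
by apply: eq_bigr => j _; rewrite addSnnS !(tnth_nth s).
Qed.

Lemma mixture_from_cat (R : realType) (Omega M : finType) (k : nat)
    (w : k.-tuple R) (P : M -> Omega -> R) (n : nat) (I J : seq M) (x : Omega) :
  mixture_from w P n (I ++ J) x
    = mixture_from w P n I x + mixture_from w P (n + size I) J x.
Proof.
elim: I n => [|s I IH] n; last by rewrite /= !mixture_from_cons IH addnS addrA.
by rewrite /= addn0 /(mixture_from _ _ _ [::] _) big_ord0 add0r.
Qed.

(** The weights on [B] start at [(size A).+1] whatever [s] is, so changing [s] affects the middle
    term only. *)
Lemma mixture_rcons_cat (R : realType) (Omega M : finType) (k : nat)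
    (w : k.-tuple R) (P : M -> Omega -> R) (A B : seq M) (s : M) (x : Omega) :
  mixture w P (rcons A s ++ B) x = mixture w P A x + w`_(size A) * P s x
    + mixture_from w P (size A).+1 B x.
Proof.
rewrite -[mixture _ _ (_ ++ _) _]/(mixture_from w P 0 (rcons A s ++ B) x).
by rewrite cat_rcons mixture_from_cat mixture_from_cons add0n addrA.
Qed.

Lemma mixture_distribution (R : realType) (Omega M : finType) (k : nat)
    (w : k.-tuple R) (P : M -> Omega -> R) (I : seq M) :
  (forall j, 0 <= w`_j) -> \sum_(j < k) w`_j = 1 ->
  (forall i, is_distribution (P i)) -> size I = k ->
  is_distribution (mixture w P I).
Proof.
move=> w0 w1 hP sI; split=> [x|]; first exact: (@mixture_from_ge0 _ _ _ _ _ _ 0).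
rewrite exchange_big/= -w1; transitivity (\sum_(j < size I) w`_j); last by rewrite sI.
by apply: eq_bigr => j _; rewrite -mulr_sumr (hP _).2 mulr1.
Qed.

(** * Testing the maximum on particular distributions *)

Lemma distribution_sub (R : realType) (Omega : finType) (q : Omega -> R) :
  is_distribution q -> is_subdistribution q.
Proof. by move=> [q0 q1]; split; rewrite ?q1. Qed.

Definition point_mass (R : realType) (Omega : finType) (x : Omega) : Omega -> R :=
  fun z => (z == x)%:R.

Lemma point_mass_distribution (R : realType) (Omega : finType) (x : Omega) :
  is_distribution (@point_mass R Omega x).
Proof.
split=> [z|]; first exact: ler0n.
by rewrite (bigD1 x)//= /point_mass eqxx big1 ?addr0// => z /negPf ->.
Qed.

(** Test a point mass against itself scaled by [t^-1], a subdistribution because [1 <= t]; the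
    divergence is [f t / t]. *)
Lemma fdiv_max_linearly_bounded (R : realType) (Omega : finType) (f : R -> R)
    (d : R) (x : Omega) :
  fdiv_max Omega f d -> linearly_bounded f.
Proof.
move=> [_ dmax]; exists d => t t1; have t0 : 0 < t by lra.
have q_sub : is_subdistribution (fun z => t^-1 * @point_mass R Omega x z).
  split=> [z|]; first by rewrite mulr_ge0 ?ler0n// invr_ge0 ltW.
  by rewrite -mulr_sumr (point_mass_distribution R x).2 mulr1 invf_le1.
have := dmax _ _ (point_mass_distribution R x) q_sub.
(* Elsewhere the term is 0 times a limit, which is 0 in [\bar R] even before the limit is known to
   be finite. *)
rewrite /fdiv (bigD1 x)//= big1 => [|z /negPf zx]; last first.
  by rewrite /fdiv_term /point_mass zx mulr0 eqxx mul0e.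
rewrite adde0 /fdiv_term /point_mass eqxx mulr1 invr_eq0 (gt_eqF t0) div1r invrK.
by rewrite lee_fin ler_pdivrMr.
Qed.

(** Of two distinct point masses, [x] contributes the slope at infinity and [y] contributes
    [f 0]. *)
Lemma fdiv_max_ge_recession (R : realType) (Omega : finType) (f : R -> R)
    (d : R) (x y : Omega) :
  convex_function (`[0, +oo[%classic : set R^o) f -> fdiv_max Omega f d ->
  x != y -> recession_slope f + f 0 <= d.
Proof.
move=> cf dm xy; have bf := fdiv_max_linearly_bounded x dm.
have := dm.2 _ _ (point_mass_distribution R x)
  (distribution_sub (point_mass_distribution R y)).
rewrite fdivE// lee_fin (bigD1 x)//= (bigD1 y) 1?eq_sym//= big1.
  rewrite /point_mass !eqxx (negPf xy) eq_sym (negPf xy) addr0 persp0l mulr1.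
  by rewrite /persp eqxx mul1r.
by move=> z /andP[/negPf zx /negPf zy]; rewrite /point_mass zx zy persp0l mulr0.
Qed.

Lemma fdiv_max_ge0 (R : realType) (Omega : finType) (p : Omega -> R) (f : R -> R)
    (d : R) :
  is_distribution p ->
  convex_function (`[0, +oo[%classic : set R^o) f -> linearly_bounded f ->
  f 1 = 0 -> fdiv_max Omega f d -> 0 <= d.
Proof.
move=> hp cf bf f1 dm; have := dm.2 p p hp (distribution_sub hp).
by rewrite fdivE// big1 => [|x _]; rewrite ?perspxx.
Qed.

(** * The exchange inequality and the greedy list *)

Lemma overlapE (R : realType) (Omega : finType) (f : R -> R) (d : R)
    (p q : Omega -> R) :
  convex_function (`[0, +oo[%classic : set R^o) f -> linearly_bounded f ->
  overlap f d p q = d - \sum_x persp f (p x) (q x).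
Proof. by move=> cf bf; rewrite /overlap fdivE. Qed.

(* The slack [f 0 * w_|A|] makes the inequality hold whatever the sign of [f 0]. *)
Lemma overlap_exchange (R : realType) (Omega M : finType) (p : Omega -> R)
    (P : M -> Omega -> R) (k : nat) (w : k.-tuple R) (f : R -> R) (d : R)
    (A B : seq M) (s s' : M) (F := fun I => overlap f d p (mixture w P I)) :
  is_distribution p -> (forall i, is_distribution (P i)) -> (forall j, 0 <= w`_j) ->
  convex_function (`[0, +oo[%classic : set R^o) f -> linearly_bounded f ->
  F (rcons A s ++ B) - F (rcons A s' ++ B)
    <= F (rcons A s) - F A + f 0 * w`_(size A).
Proof.
move=> hp hP w0 cf bf; rewrite /F !overlapE//.
(* Since [P s'] has total mass 1, the slack spreads over [Omega] and the inequality can be proved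
   pointwise. *)
have wP : f 0 * w`_(size A) = \sum_x f 0 * (w`_(size A) * P s' x).
  by rewrite -!mulr_sumr (hP _).2 mulr1.
suff : \sum_x (persp f (p x) (mixture w P (rcons A s) x)
               - persp f (p x) (mixture w P A x))
    <= \sum_x (persp f (p x) (mixture w P (rcons A s ++ B) x)
               - persp f (p x) (mixture w P (rcons A s' ++ B) x)
               + f 0 * (w`_(size A) * P s' x)).
  by rewrite sumrB [leRHS]big_split/= sumrB -wP; lra.
apply: ler_sum => x _.
have -> : mixture w P (rcons A s) x = mixture w P A x + w`_(size A) * P s x.
  by rewrite -[rcons A s]cats0 mixture_rcons_cat /mixture_from big_ord0 addr0.
rewrite !mixture_rcons_cat; apply: persp_exchange => //; first exact: hp.1.
- exact: (@mixture_from_ge0 _ _ _ _ _ _ 0).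
- by rewrite mulr_ge0//; exact: (hP _).1.
- by rewrite mulr_ge0//; exact: (hP _).1.
- exact: mixture_from_ge0.
Qed.

Lemma greedy_size (R : realType) (M : finType) (F : seq M -> R) (l : nat) (A : seq M) :
  greedy F l A -> size A = l.
Proof. by elim=> // {}l {}A a _ <- _; rewrite size_rcons. Qed.

(* Replace the elements of [S] one at a time by those of [A]: each replacement
   loses at most what the corresponding greedy step gains, up to [c]. *)
Lemma greedy_exchange (R : realType) (M : finType) (F : seq M -> R) (c : nat -> R)
    (l : nat) (A : seq M) :
  (forall A B s s', F (rcons A s ++ B) - F (rcons A s' ++ B)
     <= F (rcons A s) - F A + c (size A)) ->
  greedy F l A -> forall S B, size S = l ->
  F (S ++ B) - F (A ++ B) <= F A - F [::] + \sum_(j < l) c j.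
Proof.
move=> Fc; elim=> [|{}l {}A a gA IH amax] S B.
  by move=> /size0nil ->; rewrite big_ord0 !subrr addr0.
(* With [s :: B] as the tail, [s] stays in place while the items before it are traded; then it is
   traded for [a]. *)
case/lastP: S => // S s; rewrite size_rcons => -[/(IH S (s :: B)) {}IH].
have := Fc A B s a; have := amax s.
rewrite big_ord_recr/= (greedy_size gA) !cat_rcons; lra.
Qed.

(** Lists of one length form a finite type of tuples, inhabited by [A]. *)
Lemma is_max_size (R : realType) (M : finType) (F : seq M -> R) (A : seq M) :
  exists2 S : seq M, size S = size A &
    is_max [set F I | I in [set I : seq M | size I = size A]] (F S).
Proof.
have [S _ Smax] := @arg_maxP _ R _ (in_tuple A) predT (fun I => F I) isT.
exists S; first exact: size_tuple.
split; first by exists S => //=; exact: size_tuple.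
by move=> _ [I /= /eqP sI <-]; exact: (Smax (Tuple sI)).
Qed.

(** Submodularity can fail when [f 0 > 0]: for [f t = max(1 - t, 0)], [p] a point mass, [s]
    distributed as [p] and [s'] as another point mass, empty [A] and [B] give a gain of 0 against a
    difference equal to the first weight, which is positive. *)
Theorem theorem3 (R : realType) (Omega M : finType) (p : Omega -> R)
  (P : M -> Omega -> R) (k : nat) (w : k.-tuple R) (f : R -> R) (d : R)
  (hp : is_distribution p) (hP : forall i, is_distribution (P i)) (hk : (1 <= k)%N)
  (hw_dec : forall i j : 'I_k, (i <= j)%N -> w`_j <= w`_i)
  (hw_ge0 : forall i : 'I_k, 0 <= w`_i)
  (hw_sum : \sum_(i < k) w`_i = 1)
  (hf_convex : convex_function (`[0, +oo[%classic : set R^o) f) (hf1 : f 1 = 0)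
  (hd : fdiv_max Omega f d) :
  let F := fun I : seq M => overlap f d p (mixture w P I) in
  (f 0 <= 0 -> ordered_submodular k F) /\
  (forall A : seq M, greedy F k A ->
     size A = k /\
     exists2 m : R, is_max [set F I | I in [set I : seq M | size I = k]] m &
                    F A >= 2^-1 * m).
Proof.
(* Positions past [k] read the default weight 0, so the exchange inequality holds for lists of any
   length. *)
move=> F; have w0 j : 0 <= w`_j.
  have [jk|kj] := ltnP j k; first exact: (hw_ge0 (Ordinal jk)).
  by rewrite nth_default ?size_tuple.
(* Total mass 1 makes [Omega] inhabited, as the point mass test requires. *)
have [x _] : exists x, p x != 0.
  apply/existsP; apply: contraPT hp.2 => /existsPn p0.
  by rewrite big1 => [/eqP|x _]; [rewrite eq_sym oner_eq0 | exact/eqP/negbNE/p0].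
have bf := fdiv_max_linearly_bounded x hd.
have Fex A B s s' := overlap_exchange d A B s s' hp hP w0 hf_convex bf.
split=> [f0 A B s s' _|A gA].
  by apply: le_trans (Fex A B s s') _; rewrite gerDl mulr_le0_ge0.
have sA := greedy_size gA; split=> //.
have [S] := is_max_size F A; rewrite sA => sS Smax; exists (F S) => //.
have [[y xy]|Omega1] := pselect (exists y, x != y); last first.
  (* On one point, [p] and every full-length mixture are the constant 1. *)
  have Fd I : size I = k -> F I = d.
    move=> sI; have dist1 (q : Omega -> R) : is_distribution q -> q = fun=> 1 :> R.
      move=> [_ q1]; apply/funext => z; rewrite -q1 (bigD1 z)//= big1 ?addr0//.
      move=> y yz; case: Omega1.
      by have [xz|] := eqVneq x z; [exists y; rewrite xz eq_sym | exists z].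
    rewrite /F overlapE// (dist1 p hp) (dist1 _ (mixture_distribution w0 hw_sum hP sI)).
    by rewrite big1 ?subr0// => z _; rewrite perspxx.
  rewrite !Fd//; have := fdiv_max_ge0 hp hf_convex bf hf1 hd; lra.
have := fdiv_max_ge_recession hf_convex hd xy.
have := @greedy_exchange _ _ F (fun j => f 0 * w`_j) _ _ Fex gA _ [::] sS.
rewrite !cats0 -mulr_sumr hw_sum mulr1.
(* Every term takes the branch [v == 0] of [persp], and [p] sums to 1. *)
have : F [::] = d - recession_slope f.
  rewrite /F overlapE//; congr (_ - _).
  rewrite -[RHS]mul1r -hp.2 mulr_suml; apply: eq_bigr => z _.
  by rewrite /persp /mixture big_ord0 eqxx.
rewrite -/F; lra.
Qed.
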